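(* Assume the Continuum Hypothesis. Then there are countably tight, zero-dimensional Hausdorff spaces $X_1,X_2,X_3,X_4$ such that (1) $X_1$ is fin-SP but not $1$-SP; (2) $X_2$ is $ClScat$-SP but not fin-SP; (3) $X_3$ is $Scat$-SP but not $ClScat$-SP; (4) $X_4$ is pseudocompact but not $Nwd$-SP.
   Context: For a topological space $X$ and $\mathcal A\subseteq\mathcal P(X)$, $X$ is called $\mathcal A$-selectively pseudocompact ($\mathcal A$-SP) if for every sequence $\langle U_n:n\in\omega\rangle$ of pairwise disjoint non-empty open subsets of $X$ one can choose sets $A_n\in\mathcal A$ with $A_n\subseteq U_n$ such that the family $\{A_n:n\in\omega\}$ has an accumulation point, i.e. there is a point $x\in X$ every neighbourhood of which meets $A_n$ for infinitely many $n$. Then: $X$ is $1$-SP if it is $[X]^1$-SP (i.e. singletons are chosen; this is selective pseudocompactness); $X$ is fin-SP if it is $[X]^{<\omega}$-SP (finite subsets); $X$ is $ClScat$-SP if it is $\mathcal A$-SP for $\mathcal A$ the family of closed scattered subsets of $X$; $X$ is $Scat$-SP if $\mathcal A$ is the family of scattered subsets of $X$; $X$ is $Nwd$-SP if $\mathcal A$ is the family of nowhere dense subsets of $X$. A set is scattered if each of its non-empty subsets has a point isolated in that subset. *)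

(* Defs.v *)
From HB Require Import structures.
From mathcomp Require Import all_boot all_order all_algebra.
From mathcomp Require Import all_classical all_reals all_analysis.
From mathcomp Require Import Rstruct Rstruct_topology.

Set Implicit Arguments. Unset Strict Implicit. Unset Printing Implicit Defensive.
Import Order.TTheory GRing.Theory Num.Theory.
Local Open Scope classical_set_scope.
Local Open Scope card_scope.
Local Open Scope ring_scope.

Definition CH : Prop :=
  forall A : set Rdefinitions.R, countable A \/ A #= [set: Rdefinitions.R].

Section Defs.
Context {X : topologicalType}.

Definition accumulation_point_family (A : nat -> set X) (x : X) : Prop :=
  forall N, nbhs x N -> infinite_set [set n | A n `&` N !=set0].

Definition sel_pseudocompact (calA : set (set X)) : Prop :=
  forall U : nat -> set X,
    (forall n, open (U n)) ->
    (forall n, U n !=set0) ->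
    (forall n m, n <> m -> U n `&` U m = set0) ->
    exists A : nat -> set X,
      (forall n, calA (A n) /\ A n `<=` U n) /\
      exists x : X, accumulation_point_family A x.

Definition singletons : set (set X) := [set S | exists x, S = [set x]].
Definition finite_subsets : set (set X) := [set S | finite_set S].

Definition scattered (S : set X) : Prop :=
  forall B, B `<=` S -> B !=set0 ->
    exists2 x, B x & exists V, open V /\ V `&` B = [set x].

Definition scattered_subsets : set (set X) := [set S | scattered S].
Definition closed_scattered_subsets : set (set X) :=
  [set S | closed S /\ scattered S].
Definition nowhere_dense (S : set X) : Prop := interior (closure S) = set0.
Definition nowhere_dense_subsets : set (set X) := [set S | nowhere_dense S].

Definition one_SP := sel_pseudocompact singletons.
Definition fin_SP := sel_pseudocompact finite_subsets.
Definition ClScat_SP := sel_pseudocompact closed_scattered_subsets.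
Definition Scat_SP := sel_pseudocompact scattered_subsets.
Definition Nwd_SP := sel_pseudocompact nowhere_dense_subsets.

Definition pseudocompact : Prop :=
  forall f : X -> Rdefinitions.R, continuous f ->
    exists M : Rdefinitions.R, forall x, `|f x| <= M.

Definition countably_tight : Prop :=
  forall (A : set X) (x : X), closure A x ->
    exists2 B, B `<=` A & countable B /\ closure B x.

Definition zero_dim : Prop :=
  forall (x : X) (U : set X), nbhs x U ->
    exists V, [/\ open V, closed V, V x & V `<=` U].

Definition ct_zd_T2 : Prop := [/\ countably_tight, zero_dim & hausdorff_space X].
End Defs.

(* Main.v *)
(** Each space consists of countably many disjoint clopen copies [i n] of the
Cantor set together with limit points [x_t], all of them points of a Cantor cube
[J -> bool].  A task [t] is a pair of a sequence of closed sets [A_n] and a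
sequence of open sets [O_n] of the Cantor set; under CH the tasks are well ordered
with countable initial segments.  At stage [t] choose good sets [F_n] inside [O_n]
and clopen sets [B_n] around the bad sets [A_n].  The sets [B_n] together form a
new clopen set of the space, which contains no [x_u] with [u <= t]; the point
[x_t] is a limit of the [F_n] along an ultrafilter.  So [F_n] will accumulate at
[x_t] provided that finitely many later sets [B] never cover [F_n], and this is
achieved by taking [F_n] large and the [B_n] small in the sense of a finite game:
[S] has rank [k + 1] if the complement of some clopen neighbourhood of any given
bad set still meets [S] in a set of rank [k].  Bad selectors do not accumulate,
because each one is covered by arbitrarily late clopen sets.  Every [x_t] lies in
only countably many of the clopen sets, so the limit points form a subspace of a
Sigma-product; this gives countable tightness. *)

From HB Require Import structures.
From mathcomp Require Import all_boot all_order all_algebra.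
From mathcomp Require Import all_classical all_reals all_analysis.
From mathcomp Require Import Rstruct Rstruct_topology.
From mathcomp Require Import wochoice lra.
Require Import Defs.

Set Implicit Arguments. Unset Strict Implicit. Unset Printing Implicit Defensive.
Import Order.TTheory GRing.Theory Num.Theory.
Local Open Scope classical_set_scope.

(** * Subspaces of Cantor cubes *)

(* [X] with the topology pulled back along [c] from the Cantor cube [J -> bool]. *)
Definition trace_space (J X : Type) (c : X -> J -> bool) : Type := X.

Section TraceSpace.
Variables (J X : Type) (c : X -> J -> bool).
Local Notation S := (trace_space c).

Definition box (x : X) (l : seq J) : set X :=
  [set y | all (fun j => c y j == c x j) l].

Definition box_nbhs (x : S) : set (set S) := [set A | exists l, box x l `<=` A].

HB.instance Definition _ := gen_eqMixin S.
HB.instance Definition _ := gen_choiceMixin S.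
HB.instance Definition _ := hasNbhs.Build S box_nbhs.

Lemma box_refl x l : box x l x.
Proof. by rewrite /box/=; elim: l => //= j l ->; rewrite eqxx. Qed.

Lemma box_cat x l1 l2 : box x (l1 ++ l2) = box x l1 `&` box x l2.
Proof. by apply/seteqP; split=> y; rewrite /box/= all_cat => /andP. Qed.

Lemma box_eq x y l : box x l y -> box y l = box x l.
Proof.
rewrite /box/=; elim: l => [|j l IH]; first by move=> _; apply/seteqP; split.
move=> /= /andP[/eqP e /IH H]; apply/seteqP; split=> z /=.
  by rewrite e => /andP[-> ?] /=; move: H => /seteqP[+ _]; apply.
by rewrite -e => /andP[-> ?] /=; move: H => /seteqP[_]; apply.
Qed.

Let box_filter (x : S) : ProperFilter (nbhs x).
Proof.
apply: Build_ProperFilter_ex.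
  by move=> A [l lA]; exists x; apply: lA; exact: box_refl.
split; first by exists [::].
- move=> A B [l lA] [k kB]; exists (l ++ k).
  by rewrite box_cat => y [? ?]; split; [apply: lA|apply: kB].
- by move=> A B AB [l lA]; exists l; apply: subset_trans AB.
Qed.

Let box_singleton (x : S) (A : set S) : nbhs x A -> A x.
Proof. by move=> [l]; apply; exact: box_refl. Qed.

Let box_nbhs_nbhs (x : S) (A : set S) : nbhs x A -> nbhs x (nbhs^~ A).
Proof. by move=> [l lA]; exists l => y xy; exists l; rewrite (box_eq xy). Qed.

HB.instance Definition _ :=
  Nbhs_isNbhsTopological.Build S box_filter box_singleton box_nbhs_nbhs.

Lemma box_open (x : S) l : open (box x l : set S).
Proof. by rewrite openE => y xy; exists l; rewrite (box_eq xy). Qed.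

Lemma box_closed (x : S) l : closed (box x l : set S).
Proof.
move=> y /(_ (box y l)) []; first by exists l.
by move=> z [xz yz]; rewrite -(box_eq xz) (box_eq yz); exact: box_refl.
Qed.

Lemma trace_open_coord j b : open ([set x | c x j = b] : set S).
Proof. by rewrite openE => x <-; exists [:: j] => y; rewrite /box/= andbT => /eqP. Qed.

Lemma trace_closed_coord j b : closed ([set x | c x j = b] : set S).
Proof.
rewrite (_ : [set _ | _] = ~` [set x | c x j = ~~ b]).
  by apply: open_closedC; exact: trace_open_coord.
by apply/seteqP; split=> x /=; case: (c x j); case: b.
Qed.

Lemma trace_zero_dim : @zero_dim S.
Proof.
move=> x U [l lU]; exists (box x l); split=> //.
- exact: box_open.
- exact: box_closed.
- exact: box_refl.
Qed.

Lemma trace_hausdorff : injective c -> hausdorff_space S.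
Proof.
move=> ci x y xy; apply: ci; apply/funext => j.
have [] := xy (box x [:: j]) (box y [:: j]); [by exists [:: j]|by exists [:: j]|].
by move=> z [] /=; rewrite /box/= !andbT => /eqP-> /eqP.
Qed.
End TraceSpace.

(** * Largeness *)

(** The conjunct [big bad k S] makes largeness decrease in [k] whatever [bad] is; without it an
    empty [bad] would give even the empty set every positive rank. *)
Fixpoint big (X : topologicalType) (bad : set (set X)) (k : nat) (S : set X) : Prop :=
  if k is k.+1 then
    big bad k S /\
    forall A, bad A -> exists B, [/\ clopen B, A `<=` B & big bad k (S `\` B)]
  else S !=set0.

Section Big.
Variables (X : topologicalType) (bad : set (set X)).
Implicit Types (S A B O V : set X).

Lemma big_sub k S S' : S `<=` S' -> big bad k S -> big bad k S'.
Proof.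
elim: k S S' => [|k IH] S S' SS' /=; first by move=> [x /SS']; exists x.
move=> [bS game]; split; first exact: IH bS.
move=> A /game[B [cB AB bB]]; exists B; split=> //.
by apply: IH bB => x [/SS'].
Qed.

Lemma big_leq k k' S : k <= k' -> big bad k' S -> big bad k S.
Proof.
elim: k' => [|k' IH]; first by rewrite leqn0 => /eqP->.
by rewrite leq_eqVlt => /predU1P[->//|]; rewrite ltnS => /IH + [bS _]; apply.
Qed.

Lemma big_nonempty k S : big bad k S -> S !=set0.
Proof. exact: (@big_leq 0). Qed.

(** Intersecting the answers for the single [S i] gives one answer for all of them: a smaller [B]
    removes less, and [big] is monotone in the set. *)
Lemma clopen_avoiding (S : nat -> set X) (k : nat -> nat) n A : bad A ->
  exists B, [/\ clopen B, A `<=` B &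
    forall i, i < n -> big bad (k i).+1 (S i) -> big bad (k i) (S i `\` B)].
Proof.
move=> bA; elim: n => [|n [B [cB AB HB]]].
  by exists setT; split=> //; exact: clopenT.
have [[bn /(_ A bA)[B' [cB' AB' HB']]]|nb] := pselect (big bad (k n).+1 (S n)); last first.
  exists B; split=> // i; rewrite ltnS leq_eqVlt => /predU1P[->//|]; exact: HB.
exists (B `&` B'); split; [exact: clopenI|by move=> x Ax; split; [apply: AB|apply: AB']|].
move=> i; rewrite ltnS leq_eqVlt => /predU1P[-> _|/HB{}HB /HB{}HB].
  by apply: big_sub HB' => x [Sx nB']; split=> // -[].
by apply: big_sub HB => x [Sx nB]; split=> // -[].
Qed.

Lemma open_deciding (E : nat -> set X) n O : (forall i, clopen (E i)) ->
  open O -> O !=set0 ->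
  exists V, [/\ open V, V !=set0, V `<=` O &
    forall i, i < n -> V `<=` E i \/ V `&` E i = set0].
Proof.
move=> cE oO O0; elim: n => [|n [V [oV V0 VO VE]]]; first by exists O; split.
have [VEn|VEn] := pselect (V `&` E n !=set0).
  exists (V `&` E n); split=> //.
  - by apply: openI => //; case: (cE n).
  - by move=> x [/VO].
  - move=> i; rewrite ltnS leq_eqVlt => /predU1P[->|/VE[VEi|VEi]].
    + by left=> x [].
    + by left=> x [/VEi].
    + by right; rewrite setIAC VEi set0I.
exists V; split=> // i; rewrite ltnS leq_eqVlt => /predU1P[->|/VE//].
by right; apply/eqP; apply: contra_notT VEn => /set0P.
Qed.
End Big.

(** * The transfinite recursion *)

Lemma wf_recursive_choice (T : Type) (D : choiceType) (lt : T -> T -> Prop) (d0 : D)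
    (G : set D) (P : (T -> D) -> T -> set D) :
  well_founded lt -> G d0 ->
  (forall f g t, (forall u, lt u t -> f u = g u) -> P f t `<=` P g t) ->
  (forall f t, (forall u, G (f u)) -> exists d, G d /\ P f t d) ->
  exists f, forall t, G (f t) /\ P f t (f t).
Proof.
move=> wf Gd0 Pext Pex.
(* Outside the segment below [t] the value is [d0]; by [G d0] the restricted function satisfies [G]
   everywhere, as [Pex] asks. *)
pose restr t (rec : forall u, lt u t -> D) u :=
  if pselect (lt u t) is left h then rec u h else d0.
pose step t rec := xget d0 [set d | G d /\ P (restr t rec) t d].
pose f := Fix wf (fun=> D) step.
have fE t : f t = step t (fun u _ => f u).
  rewrite /f Fix_eq // => x r r' rr'; congr (step x _).
  apply: functional_extensionality_dep => u.
  by apply: functional_extensionality_dep => h; exact: rr'.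
have fG t : G (f t) /\ P (restr t (fun u _ => f u)) t (f t).
  elim/(well_founded_ind wf): t => t IH; rewrite fE /step.
  have [u|d Pd] := Pex (restr t (fun u _ => f u)) t.
    by rewrite /restr; case: pselect => // /IH[].
  by apply: (@xgetPex _ d0 [set d | G d /\ P (restr t (fun u _ => f u)) t d]); exists d.
exists f => t; have [Gt Pt] := fG t; split=> //.
by apply: Pext Pt => u ut; rewrite /restr; case: pselect.
Qed.

Section Recursion.
Variables (X : topologicalType) (x0 : X) (bad good : set (set X)).
Variables (T : choiceType) (lt : T -> T -> Prop).
Variables (a o : T -> nat -> set X).
Hypothesis lt_wf : well_founded lt.
Hypothesis lt_trans : forall u v w, lt u v -> lt v w -> lt u w.
Hypothesis lt_total : forall u v, lt u v \/ u = v \/ lt v u.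
Hypothesis lt_countable : forall t, countable [set u | lt u t].
Hypothesis o_open : forall t n, open (o t n).
Hypothesis good_big : forall V k, open V -> V !=set0 ->
  exists F, [/\ good F, F `<=` V & big bad k F].
Local Notation D := ((nat -> set X) * (nat -> set X))%type.
Implicit Types (f : T -> D) (H : seq T).

(* The data [(f t).1] and [(f t).2] of a stage are the sequences [F_n] and [B_n]. *)
Definition leftover f u H n : set X :=
  (f u).1 n `\` (f u).2 n `\` \bigcup_(g in [set` H]) (f g).2 n.

(** The fourth clause lets the [F_n] converge at the coordinates of earlier stages; the last one
    protects the sets of earlier stages from the new [B_n]. There [n - (size H).+1] is one below the
    rank expected after the removals in [H], so each later stage costs one rank. *)
Definition stage f t : set D := [set d |
  [/\ forall n, bad (a t n) -> a t n `<=` d.2 n,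
      forall n, good (d.1 n) /\ (o t n !=set0 -> d.1 n `<=` o t n),
      forall n, big bad n (d.1 n `\` d.2 n),
      forall u, lt u t -> exists N, forall n, N <= n ->
        d.1 n `<=` (f u).2 n \/ d.1 n `&` (f u).2 n = set0 &
      forall u H, lt u t -> {in H, forall g, lt g t} ->
        exists N, forall n, N <= n ->
          big bad (n - (size H).+1).+1 (leftover f u H n) ->
          big bad (n - (size H).+1) (leftover f u H n `\` d.2 n)]].

Lemma leftover_ext f g u H : f u = g u -> {in H, f =1 g} ->
  leftover f u H = leftover g u H.
Proof.
move=> fgu fgH; apply/funext => n; rewrite /leftover fgu; congr (_ `\` _).
by apply: eq_bigcupr => v /fgH ->.
Qed.

Lemma stage_ext f g t : (forall u, lt u t -> f u = g u) -> stage f t `<=` stage g t.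
Proof.
move=> fg d [h1 h2 h3 h4 h5]; split=> //.
  by move=> u ut; rewrite -fg//; exact: h4.
move=> u H ut Ht; rewrite -(@leftover_ext f); [exact: h5|exact: fg|].
by move=> v /Ht; exact: fg.
Qed.

Lemma below_enum t : exists b : nat -> T, forall u, lt u t -> exists i, b i = u.
Proof.
have /countable_injP[r ri] := lt_countable t.
exists (fun i => xget t [set u | lt u t /\ r u = i]) => u ut; exists (r u).
have [ut' ru'] := xgetPex t (ex_intro [set v | lt v t /\ r v = r u] u (conj ut erefl)).
by apply: ri => //; rewrite inE.
Qed.

(** Diagonal bookkeeping: there are countably many stages, and finite lists of stages, below [t].
    Step [n] meets only the first [n] requirements, so each one is met for almost all [n]. *)
Lemma stage_exists f t : (forall u n, clopen ((f u).2 n)) ->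
  exists d : D, (forall n, clopen (d.2 n)) /\ stage f t d.
Proof.
move=> cf; have [b bP] := below_enum t.
pose e j := if unpickle j is Some (i, l) then (b i, map b l) else (t, [::]).
have eP u H : lt u t -> {in H, forall g, lt g t} -> exists j, e j = (u, H).
  move=> /bP[i <-] Ht.
  suff [l <-] : exists l, map b l = H by exists (pickle (i, l)); rewrite /e pickleK.
  elim: H Ht => [|g H IH] Ht; first by exists [::].
  have [|l <-] := IH; first by move=> v vH; apply: Ht; rewrite inE vH orbT.
  by have /bP[j <-] := Ht g (mem_head _ _); exists (j :: l).
(* Rank [n.+1] is one more than the third clause demands, because [B n] will cost one. *)
have FP n : exists F, [/\ good F /\ (o t n !=set0 -> F `<=` o t n), big bad n.+1 F &
    forall i, i < n -> F `<=` (f (b i)).2 n \/ F `&` (f (b i)).2 n = set0].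
  have [W [oW W0 Wo]] : exists W, [/\ open W, W !=set0 & o t n !=set0 -> W `<=` o t n].
    have [tne|tempty] := pselect (o t n !=set0); first by exists (o t n); split=> // _; exact: subset_refl.
    by exists setT; split=> //; [exact: openT|exists x0].
  have [V [oV V0 VW VE]] := open_deciding n (fun i => cf (b i) n) oW W0.
  have [F [gF FV bF]] := good_big n.+1 oV V0.
  exists F; split=> // [|i /VE[VEi|VEi]].
  - by split=> // /Wo; apply: subset_trans; exact: subset_trans VW.
  - by left; exact: subset_trans VEi.
  - by right; apply/seteqP; split=> // x [/FV Vx Ex]; rewrite -VEi.
have [F FP'] := choice FP.
pose S n i := if i is i.+1 then leftover f (e i).1 (e i).2 n else F n.
pose k n i := if i is i.+1 then n - (size (e i).2).+1 else n.
have BP n : exists B, [/\ clopen B, bad (a t n) -> a t n `<=` B & forall i, i < n.+1 ->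
    big bad (k n i).+1 (S n i) -> big bad (k n i) (S n i `\` B)].
  have [ba|nba] := pselect (bad (a t n)).
    by have [B [? ? ?]] := clopen_avoiding (S n) (k n) n.+1 ba; exists B; split.
  exists set0; split=> //; first exact: clopen0.
  by move=> i _; rewrite setD0; exact: big_leq.
have [B BP'] := choice BP.
exists (F, B); split; first by move=> n; have [] := BP' n.
split=> /=.
- by move=> n; have [] := BP' n.
- by move=> n; have [] := FP' n.
- by move=> n; have [_ _ /(_ 0 isT)] := BP' n; apply; have [] := FP' n.
- move=> u /bP[i <-]; exists i.+1 => n ni; have [_ _] := FP' n; exact.
- move=> u H /eP /[apply] -[j ej]; exists j.+1 => n nj.
  by have [_ _ /(_ j.+1 nj)] := BP' n; rewrite /k /S ej.
Qed.

Lemma construction : exists f, forall t, (forall n, clopen ((f t).2 n)) /\ stage f t (f t).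
Proof.
apply: (wf_recursive_choice (G := [set d | forall n, clopen (d.2 n)])
  (d0 := (fun=> set0, fun=> set0)) lt_wf).
- by move=> n; exact: clopen0.
- exact: stage_ext.
- exact: stage_exists.
Qed.

Lemma seq_max H : H != [::] -> exists2 g, g \in H & {in H, forall v, v = g \/ lt v g}.
Proof.
elim: H => // h [|h' H] IH _.
  by exists h; rewrite ?mem_head// => v; rewrite inE => /eqP; left.
have [//|g gH gmax] := IH.
have [hg|[hg|gh]] := lt_total h g.
- exists g; first by rewrite inE gH orbT.
  by move=> v; rewrite inE => /predU1P[->|/gmax]; [right|].
- exists g; first by rewrite inE gH orbT.
  by move=> v; rewrite inE => /predU1P[->|/gmax]; [left|].
- exists h; first exact: mem_head.
  move=> v; rewrite inE => /predU1P[->|/gmax[->|vg]]; [by left|by right|].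
  by right; exact: lt_trans gh.
Qed.

(** The clopen set of the largest stage [g] of [H] is removed last: the other stages lie below [g],
    so the last clause of [stage] at [g] applies to their leftover and one rank is lost. *)
Lemma leftover_big f : (forall t, stage f t (f t)) ->
  forall u H, {in H, forall g, lt u g} ->
  exists N, forall n, N <= n -> big bad (n - size H) (leftover f u H n).
Proof.
move=> fP u H; have [m] := ubnP (size H).
elim: m H => // m IH H sH uH.
have [->|H0] := eqVneq H [::].
  exists 0 => n _; rewrite /leftover subn0 set_nil bigcup_set0 setD0.
  by have [_ _ ? _ _] := fP u.
have [g gH gmax] := seq_max H0.
pose K := [seq v <- H | v != g].
have sK : size K < size H.
  rewrite size_filter -(count_predC (pred1 g) H) -[X in X < _]add0n.
  by rewrite ltn_add2r -has_count; apply/hasP; exists g => /=.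
have KH : {in K, forall v, v \in H} by move=> v; rewrite mem_filter => /andP[].
have [|v /KH /uH//|N NP] := IH K _ _; first by rewrite (leq_trans sK).
have [_ _ _ _ /(_ u K (uH _ gH))[|M MP]] := fP g.
  by move=> v; rewrite mem_filter => /andP[/eqP vg /gmax[]].
(* For [size K < n] the subtraction is not truncated: [(n - (size K).+1).+1 = n - size K]. *)
exists (maxn (size K).+1 (maxn N M)) => n; rewrite !geq_max => /and3P[nK nN nM].
apply: (@big_leq _ _ _ (n - (size K).+1)); first exact: leq_sub2l.
apply: big_sub (MP n nM _); last by rewrite -subSn// subSS; exact: NP.
move=> x [[[Fx nBx] nKx] nBg]; split=> // -[v vH Bv].
have [vg|vg] := eqVneq v g; first by move: Bv; rewrite vg.
by apply: nKx; exists v => //=; rewrite mem_filter vg.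
Qed.
End Recursion.

(** * The space *)

(** Extend the filter of sets that contain [K] up to finitely many points; all cofinite sets belong
    to it, so the ultrafilter has no finite member. For finite [K] the last claim is void and [setT]
    takes its place. *)
Lemma free_ultrafilter (K : set nat) : exists U : set (set nat),
  [/\ UltraFilter U, forall S, U S -> infinite_set S & infinite_set K -> U K].
Proof.
wlog Kinf : K / infinite_set K => [wlg|].
  have [Kinf|nKinf] := pselect (infinite_set K); first exact: wlg.
  have [U [? ? _]] := wlg setT infinite_nat.
  by exists U; split.
pose G := [set S : set nat | finite_set (K `\` S)].
have pG : ProperFilter G.
  apply: Build_ProperFilter_ex.
    move=> S GS; apply: contrapT => /forallNP S0; apply: Kinf.
    by apply: sub_finite_set GS => k Kk; split.
  split; first by rewrite /G/= setDT.
  - move=> S S' GS GS'; rewrite /G/= setDIr finite_setU; split; assumption.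
  - by move=> S S' SS'; apply: sub_finite_set; exact: setDS.
have [U [uU GU]] := ultraFilterLemma pG.
exists U; split=> // [S US Sfin|_]; last by apply: GU; rewrite /G/= setDv.
have UnS : U (~` S) by apply: GU; rewrite /G/= setDE setCK; exact: finite_setIr.
by have /filter_ex[k [Sk /(_ Sk)]] : U (S `&` ~` S) by exact: filterI.
Qed.

Definition cantor := trace_space (@id (nat -> bool)).

Definition cylinder (s : seq (nat * bool)) : set cantor :=
  [set c | all (fun p => c p.1 == p.2) s].

Lemma cylinder_box (c : cantor) l :
  cylinder [seq (i, c i) | i <- l] = box (@id (nat -> bool)) c l.
Proof. by apply/seteqP; split=> d; rewrite /cylinder /box/= all_map. Qed.

Section Space.
Variables (bad good : set (set cantor)).
Variables (T : choiceType) (lt : T -> T -> Prop).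
Variables (a o : T -> nat -> set cantor).
Hypothesis lt_trans : forall u v w, lt u v -> lt v w -> lt u w.
Hypothesis lt_total : forall u v, lt u v \/ u = v \/ lt v u.
Hypothesis lt_countable : forall t, countable [set u | lt u t].
Hypothesis o_surj : forall O, (forall n, open (O n)) -> exists t, o t = O.
Hypothesis a_cofinal : forall A t, (forall n, closed (A n)) ->
  exists2 u, a u = A & ~ lt u t.
Hypothesis bad_closed : forall A, bad A -> closed A.
Hypothesis good_big : forall V k, open V -> V !=set0 ->
  exists F, [/\ good F, F `<=` V & big bad k F].

Variable f : T -> (nat -> set cantor) * (nat -> set cantor).
Hypothesis f_clopen : forall t n, clopen ((f t).2 n).
Hypothesis f_stage : forall t, stage bad good lt a o f t (f t).
Variable U : T -> set (set nat).
Hypothesis U_ultra : forall t, UltraFilter (U t).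
Hypothesis U_infinite : forall t S, U t S -> infinite_set S.
Hypothesis U_active : forall t, infinite_set [set n | o t n !=set0] ->
  U t [set n | o t n !=set0].

Local Instance U_proper t : ProperFilter (U t) := @ultra_proper _ _ (U_ultra t).

Local Notation F t n := ((f t).1 n).
Local Notation B t n := ((f t).2 n).
Local Notation J := (nat * option nat + T)%type.

(** [inl (m, None)] makes the [m]-th copy clopen, [inl (m, Some i)] is its [i]-th Cantor coordinate,
    and [inr t] is the indicator of the clopen set formed by all [B t n]. *)
Definition ypt n (c : cantor) (j : J) : bool :=
  match j with
  | inl (m, None) => m == n
  | inl (m, Some i) => (m == n) && c i
  | inr t => `[< B t n c >]
  end.

(* The limit along [U t] of the sets [F t n], and [false] at the stages from [t] on. *)
Definition xpt t (j : J) : bool :=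
  match j with
  | inl _ => false
  | inr u => `[< lt u t /\ U t [set n | F t n `<=` B u n] >]
  end.

Definition pts : Type := {q : J -> bool | (exists n c, q = ypt n c) \/ exists t, q = xpt t}.

Definition coord (q : pts) : J -> bool := sval q.

Lemma coord_inj : injective coord.
Proof.
by move=> [q Rq] [q' Rq'] /= e; subst q'; rewrite (Prop_irrelevance Rq Rq').
Qed.

Local Notation X := (trace_space coord).

Definition incl n c : X := exist _ (ypt n c) (or_introl (ex_intro _ n (ex_intro _ c erefl))).
Definition xi t : X := exist _ (xpt t) (or_intror (ex_intro _ t erefl)).

Lemma ptsP (q : X) : (exists n c, q = incl n c) \/ exists t, q = xi t.
Proof.
case: q => q /= [[n [c qE]]|[t qE]].
  by left; exists n, c; apply: coord_inj; rewrite /coord/=.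
by right; exists t; apply: coord_inj; rewrite /coord/=.
Qed.

Lemma incl_inj n m c d : incl n c = incl m d -> n = m /\ c = d.
Proof.
move=> e; have {}e j : ypt n c j = ypt m d j by have := congr1 coord e => /(congr1 (@^~ j)).
have /eqP nm := e (inl (m, None)); rewrite /= eqxx in nm.
have {}nm : m = n by apply/eqP; move: nm => /eqP.
split=> //; apply/funext => i.
by have := e (inl (n, Some i)); rewrite /= nm eqxx.
Qed.

Lemma ypt_open n j b : open ([set c | ypt n c j = b] : set cantor).
Proof.
case: j => [[m [i|]]|t] /=.
- case: (m == n) => /=; first exact: (@trace_open_coord nat (nat -> bool) id i b).
  by case: b; [rewrite (_ : [set _ | _] = set0)|rewrite (_ : [set _ | _] = setT)];
    [exact: open0|apply/seteqP; split|exact: openT|apply/seteqP; split].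
- case: (pselect ((m == n) = b)) => e.
    by rewrite (_ : [set _ | _] = setT); [exact: openT|apply/seteqP; split].
  by rewrite (_ : [set _ | _] = set0); [exact: open0|apply/seteqP; split].
- have [Bo Bc] := f_clopen t n.
  case: b.
    rewrite (_ : [set _ | _] = B t n) //.
    by apply/seteqP; split=> c /=; [move/asboolP|move=> ?; apply/asboolP].
  rewrite (_ : [set _ | _] = ~` B t n); first exact: closed_openC.
  by apply/seteqP; split=> c /=; [move/asboolPn|move=> ?; apply/asboolPn].
Qed.

Lemma incl_continuous n : continuous (incl n : cantor -> X).
Proof.
move=> c W [l lW].
have : nbhs c (incl n @^-1` box coord (incl n c) l).
  apply: open_nbhs_nbhs; split; last exact: box_refl.
  elim: l {lW} => [|j l IH].
    by rewrite (_ : _ @^-1` _ = setT); [exact: openT|apply/seteqP; split].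
  rewrite (_ : _ @^-1` _ = [set d | ypt n d j = ypt n c j] `&`
      (incl n @^-1` box coord (incl n c) l)).
    by apply: openI => //; exact: ypt_open.
  apply/seteqP; split=> d; rewrite /box/= /coord/=; first by move=> /andP[/eqP].
  by move=> [-> ->]; rewrite eqxx.
by apply: filterS => d /lW.
Qed.

(** Limit points are [false] at [inl (n, None)], so a box that fixes [true] there stays in the
    [n]-th copy; its other coordinates describe a box of the Cantor set. *)
Lemma incl_open n (V : set cantor) : open V -> open (incl n @` V : set X).
Proof.
rewrite openE => oV; rewrite openE => _ [c Vc <-].
have [l lV] := oV c Vc.
exists (inl (n, None) :: [seq inl (n, Some i) | i <- l]) => q.
rewrite /box/= => /andP[/eqP]; rewrite eqxx.
have [[m [d ->]]|[t ->]//] := ptsP q; rewrite /= => /eqP nm; subst m.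
rewrite all_map /= => ld; exists d => //; apply: lV; move: ld.
by rewrite /box/= /preim/=; apply: sub_all => i /=; rewrite eqxx.
Qed.

Lemma range_inclE n : range (incl n) = [set q : X | coord q (inl (n, None)) = true].
Proof.
apply/seteqP; split=> [_ [c _ <-]|q]; first by rewrite /= eqxx.
have [[m [d ->]]|[t ->]//] := ptsP q; rewrite /= => /eqP nm; subst m.
by exists d.
Qed.

Lemma range_incl_closed n : closed (range (incl n) : set X).
Proof. by rewrite range_inclE; exact: trace_closed_coord. Qed.

(** * Limits along the ultrafilters *)

Lemma U_ge t N : U t [set n | N <= n].
Proof.
have [//|UN] := in_ultra_setVsetC [set n | N <= n] (U_ultra t).
exfalso; apply: (U_infinite UN); apply: (sub_finite_set _ (finite_II N)) => n /=.
by rewrite ltnNge => /negP.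
Qed.

Lemma U_disjoint t S : U t (~` S) -> ~ U t S.
Proof. by move=> UnS US; have /filter_ex[n [nS /nS]] : U t (~` S `&` S) by exact: filterI. Qed.

Lemma U_all t (S : set nat) : (exists N, forall n, N <= n -> S n) -> U t S.
Proof. by move=> [N NS]; apply: filterS (U_ge t N) => n; exact: NS. Qed.

Definition early t (j : J) : Prop := if j is inr u then lt u t else True.

(** A coordinate that belongs to one copy is [false] once [n] has passed that copy. At an earlier
    stage [u] almost every [F t n] lies inside [B u n] or misses it, and the ultrafilter selects one
    alternative. *)
Lemma U_decided t j : early t j ->
  U t [set n | forall c, F t n c -> ypt n c j = xpt t j].
Proof.
case: j => [[m p] _|u ut].
  apply: U_all; exists m.+1 => n mn c _ /=.
  by case: p => [i|]; rewrite (ltn_eqF mn).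
have [_ _ _ /(_ u ut) dec _] := f_stage t.
have [UB|UnB] := in_ultra_setVsetC [set n | F t n `<=` B u n] (U_ultra t).
  have -> : xpt t (inr u) = true by apply/asboolP.
  by apply: filterS UB => n FB c Fc; apply/asboolP; exact: FB.
have -> : xpt t (inr u) = false by apply/asboolPn => -[_]; apply: U_disjoint UnB.
apply: filterS (filterI UnB (U_all t dec)) => n [nFB [//|FB0]] c Fc.
by apply/asboolPn => Bc; suff : set0 c by []; rewrite -FB0.
Qed.

Definition late t (l : seq J) : seq T :=
  pmap (fun j => if j is inr u then if `[< lt u t >] then None else Some u else None) l.

(** Early coordinates agree by [U_decided]; at late ones [xi t] is [false], so it suffices that [c]
    avoids the corresponding clopen sets. *)
Lemma U_box t l : U t [set n | forall c, F t n c ->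
  {in late t l, forall u, ~ B u n c} -> box coord (xi t) l (incl n c)].
Proof.
elim: l => [|j l IH]; first by apply: U_all; exists 0.
have [ej|[u [-> nut]]] : early t j \/
    exists u, j = inr u /\ ~ lt u t.
- by case: j => [p|u]; [left|have [ut|ut] := pselect (lt u t); [left|right; exists u]].
- apply: filterS (filterI IH (U_decided ej)) => n [IHn jn] c Fc lc.
  rewrite /box/= /coord/= jn// eqxx; apply: IHn => // u ul; apply: lc.
  by move: ul; rewrite /late/=; case: j {jn ej} => [//|v]; case: ifP => //= _;
    rewrite inE orbC => ->.
- apply: filterS IH => n IHn c Fc; rewrite /late/= asboolF//= => lc.
  rewrite /box/=; apply/andP; split.
    apply/eqP; transitivity false; last by apply/esym/asboolPn => -[].
    by apply/asboolPn; apply: lc; exact: mem_head.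
  by apply: IHn => // v vl; apply: lc; rewrite inE vl orbT.
Qed.

Lemma lateP t l u : u \in late t l -> u = t \/ lt t u.
Proof.
have nlt v : ~ lt v t -> v = t \/ lt t v by have [|[]] := lt_total v t; auto.
elim: l => //= -[//|v] l IH; case: asboolP => //= vt.
by rewrite inE => /predU1P[->|/IH//]; exact: nlt.
Qed.

(** The finitely many late coordinates ask for a point in a leftover of [F t n], which is non-empty
    for large [n]. The stage [t] is dropped from [K] because [leftover] removes [B t n] anyway. *)
Lemma xi_limit t l :
  U t [set n | exists2 c, F t n c & box coord (xi t) l (incl n c)].
Proof.
pose K := [seq u <- late t l | u != t].
have [|N NP] := leftover_big lt_trans lt_total f_stage (u := t) (H := K).
  by move=> u; rewrite mem_filter => /andP[/eqP ut /lateP[]].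
apply: filterS (filterI (U_ge t N) (U_box t l)) => n [/NP /big_nonempty].
move=> [c [[Fc nBc] nKc]] bc; exists c => //; apply: bc => // u ul Bu.
have [ut|ut] := eqVneq u t; first by move: Bu; rewrite ut.
by apply: nKc; exists u => //=; rewrite mem_filter ut.
Qed.

Lemma xi_nbhs t (N : set X) : nbhs (xi t) N ->
  U t [set n | exists2 c, F t n c & N (incl n c)].
Proof.
move=> [l lN]; apply: filterS (xi_limit t l) => n [c Fc bc].
by exists c => //; exact: lN.
Qed.

(** * Density of the copies and accumulation of selectors *)

Lemma incl_dense (W : set X) : open W -> W !=set0 -> exists n c, W (incl n c).
Proof.
move=> oW [q Wq]; have [[n [c qE]]|[t qE]] := ptsP q.
  by exists n, c; rewrite -qE.
have : nbhs (xi t) W by apply: open_nbhs_nbhs; split => //; rewrite -qE.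
by move=> /xi_nbhs /filter_ex[n [c _ Wc]]; exists n, c.
Qed.

(** A point of a copy has that copy as a neighbourhood, and it meets only one of the sets. For
    [xi t] take a stage [u] not below [t] with closed sets [A]: [xi t] is [false] at [u], while
    [B u n] covers [A n]. *)
Lemma bad_selectors (A : nat -> set cantor) (q : X) : (forall n, bad (A n)) ->
  ~ accumulation_point_family (fun n => incl n @` A n) q.
Proof.
move=> Abad; have [[n [c ->]]|[t ->]] := ptsP q => acc.
  have := acc (range (incl n)); apply.
    apply: open_nbhs_nbhs; split; last by exists c.
    by apply: incl_open; exact: openT.
  apply: (sub_finite_set _ (finite_set1 n)) => m /= [_ [[d _ <-] [e _]]].
  by move=> /incl_inj[].
have [u uA nut] := a_cofinal t (fun n => bad_closed (Abad n)).
have := acc [set r | coord r (inr u) = false]; apply.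
  apply: open_nbhs_nbhs; split; first exact: trace_open_coord.
  by apply/asboolPn => -[].
apply: (sub_finite_set _ (@finite_set0 nat)) => m /= [_ [[d Ad <-]]].
move=> /asboolPn; apply; have [aB _ _ _ _] := f_stage u.
by apply: aB; rewrite uA.
Qed.

(** If one copy is used infinitely often, compactness of the Cantor set gives the point. Otherwise
    infinitely many copies are used, and some task [t] prescribes open sets inside the [W n]; then
    [xi t] serves. *)
Lemma good_selectors (W : nat -> set X) :
  (forall n, open (W n)) -> (forall n, W n !=set0) ->
  exists (A : nat -> set cantor) (k : nat -> nat),
    (forall n, good (A n) /\ incl (k n) @` A n `<=` W n) /\
    exists q : X, accumulation_point_family (fun n => incl (k n) @` A n) q.
Proof.
move=> oW W0.
have /choice[k /choice[V kV]] n : exists m V,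
    [/\ open V, V !=set0 & incl m @` V `<=` W n].
  have [m [c Wc]] := incl_dense (oW n) (W0 n).
  exists m, (incl m @^-1` W n); split; last exact: image_preimage_subset.
    exact: (open_comp (fun c _ => @incl_continuous m c)).
  by exists c.
have /choice[G GP] n : exists G, [/\ good G, G `<=` V n & G !=set0].
  by have [oV V0 _] := kV n; have [G [? ? /big_nonempty]] := good_big 0 oV V0; exists G; split.
have GW n : incl (k n) @` G n `<=` W n.
  by have [_ GV _] := GP n; have [_ _] := kV n; apply: subset_trans; exact: image_subset.
have [[m minf]|kfin] := pselect (exists m, infinite_set [set n | k n = m]).
  exists G, k; split; first by move=> n; split => //; case: (GP n).
  have /choice[c cG] n : exists c, G n c by have [] := GP n.
  have [Y [uY Yinf /(_ minf) Ym]] := free_ultrafilter [set n | k n = m].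
  (* The limit of the points [c n] along [Y], coordinate by coordinate. *)
  pose y : cantor := fun i => `[< Y [set n | c n i] >].
  exists (incl m y) => N /(@incl_continuous m) [l lN].
  have Yl : Y [set n | box (@id (nat -> bool)) y l (c n)].
    elim: l {lN} => [|i l IH]; first by apply: filterS filterT => n.
    suff Yi : Y [set n | c n i == y i].
      by apply: filterS (filterI Yi IH) => n [/= ? ?]; apply/andP.
    rewrite /y; case: asboolP => [|nYi]; first by apply: filterS => n /= ->.
    have [//|] := in_ultra_setVsetC [set n | c n i] uY.
    by apply: filterS => n /= /negP/negbTE ->.
  apply: sub_infinite_set (Yinf _ (filterI Ym Yl)) => n [/= nm /lN Nc].
  by exists (incl (k n) (c n)); split; [exists (c n)|rewrite nm].
pose r m := xget 0 [set n | k n = m].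
pose O m := [set c | k (r m) = m /\ V (r m) c].
have kr n : k (r (k n)) = k n.
  exact: (xgetPex 0 (ex_intro (fun n' => k n' = k n) n erefl)).
have [|t tO] := @o_surj O.
  move=> m; have [km|km] := pselect (k (r m) = m).
    rewrite (_ : O m = V (r m)); first by have [] := kV (r m).
    by apply/seteqP; split=> c // -[].
  rewrite (_ : O m = set0); first exact: open0.
  by apply/seteqP; split=> c // -[].
have O0 n : O (k n) !=set0.
  by have [_ [c Vc] _] := kV (r (k n)); exists c; split.
have Uact : U t [set m | o t m !=set0].
  apply: U_active; rewrite tO => Ofin; apply: infinite_nat.
  suff -> : [set: nat] = \bigcup_(m in [set m | O m !=set0]) [set n | k n = m].
    apply: bigcup_finite => // m _; apply: contrapT => minf.
    by apply: kfin; exists m.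
  by apply/seteqP; split=> n // _; exists (k n) => //; exact: O0.
have [_ Fgood _ _ _] := f_stage t.
exists (fun n => if r (k n) == n then F t (k n) else G n), k; split.
  move=> n; case: eqP => [rkn|_]; last by split => //; case: (GP n).
  have [gF FO] := Fgood (k n); split=> //.
  have [_ _] := kV n; apply: subset_trans; apply: image_subset.
  by rewrite tO in FO; apply: subset_trans (FO (O0 n)) _ => c [_]; rewrite rkn.
exists (xi t) => N /xi_nbhs UN; rewrite tO in Uact.
move=> Efin; apply: (U_infinite (filterI UN Uact)); move: Efin => /(finite_image k).
apply: sub_finite_set => m [[c Fc Nc] [d [krm _]]]; exists (r m) => //=.
by rewrite krm eqxx; exists (incl m c); split=> //; exists c.
Qed.

(** * Countable tightness *)

Lemma incl_part_tight (A : set X) (q : X) : closure (A `&` \bigcup_n range (incl n)) q ->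
  exists2 D, D `<=` A & countable D /\ closure D q.
Proof.
(* One point of [A] is taken from each member of the countable base of the copies that meets [A]. *)
move=> clA; pose g p := A `&` incl p.1 @` cylinder p.2.
exists [set r | exists2 p, g p !=set0 & r = xget q (g p)].
  by move=> _ [p [r gr] ->]; have [] := xgetPex q (ex_intro (g p) r gr).
split.
  apply: sub_countable (countableP [set: nat * seq (nat * bool)]).
  apply: (@card_le_trans _ _ _ (range (fun p => xget q (g p)))); last exact: card_image_le.
  by apply: subset_card_le => _ [p _ ->]; exists p.
move=> N; rewrite nbhsE => -[M [oM Mq] MN].
have [r [[Ar [n _ [c _ rE]]] Mr]] := clA M (open_nbhs_nbhs (conj oM Mq)); subst r.
have [l lM] : nbhs c (incl n @^-1` M).
  by apply: incl_continuous; exact: open_nbhs_nbhs.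
have g0 : g (n, [seq (i, c i) | i <- l]) (incl n c).
  by split=> //; exists c => //=; rewrite cylinder_box; exact: box_refl.
exists (xget q (g (n, [seq (i, c i) | i <- l]))); split.
  by eexists; [|reflexivity]; exists (incl n c).
have [_ [d ld <-]] := xgetPex q (ex_intro (g _) _ g0).
by apply: MN; apply: lM; rewrite -cylinder_box.
Qed.

(** A copy is open and free of limit points, so [q] is some [xi t]. All limit points have countable
    support, as in a Sigma-product, and closing off under the choice of finite approximations yields
    a countable set. *)
Lemma xi_part_tight (A : set X) (q : X) : closure (A `&` range xi) q ->
  exists2 D, D `<=` A & countable D /\ closure D q.
Proof.
have [[n [c ->]]|[t ->]] := ptsP q => clA.
  have [|r [[_ [t _ <-]] [d _ /(congr1 (fun r => coord r (inl (n, None))))]]] :=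
    clA (range (incl n)).
    by apply: open_nbhs_nbhs; split; [apply: incl_open; exact: openT|exists c].
  by rewrite /= eqxx.
have /choice[w wP] H : exists u, A (xi u) /\
    box coord (xi t) [seq inr v | v <- H] (xi u).
  have [|r [[Ar [u _ uE]] br]] := clA (box coord (xi t) [seq inr v | v <- H]).
    by exists [seq inr v | v <- H].
  by exists u; rewrite uE.
have /choice[b bP] u := below_enum lt_countable u.
(* Close off under [w]: the range of [Z] is countable, and it contains the supports
   of [xi t] and of every [xi (w H)] with [H] a list of elements of this range. *)
pose Z := fix Z (x : GenTree.tree nat) : T := match x with
  | GenTree.Leaf m => b t m
  | GenTree.Node m ts => b (w (map Z ts)) m end.
exists (range (fun ts => xi (w (map Z ts)))).
  by move=> _ [ts _ <-]; have [] := wP (map Z ts).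
split.
  exact: (card_le_trans (card_image_le _ _) (countableP _)).
move=> N [l lN].
pose H := [seq u <- pmap (fun j : J => if j is inr u then Some u else None) l | `[< range Z u >]].
have [ts tsH] : exists ts, map Z ts = H.
  have : {in H, forall u, range Z u}.
    by move=> u; rewrite mem_filter => /andP[/asboolP].
  elim: H => [|u H IH] HZ; first by exists [::].
  have [|ts <-] := IH; first by move=> v vH; apply: HZ; rewrite inE vH orbT.
  by have [x _ <-] := HZ u (mem_head _ _); exists (x :: ts).
exists (xi (w (map Z ts))); split; first by exists ts.
apply: lN; have [_] := wP (map Z ts); rewrite {1}tsH /H.
(* Off the range of [Z] both points are [false]; the coordinates of [l] in this range are listed by
   [ts], and there the points agree by the choice of [w]. *)
have ZP u : coord (xi t) (inr u) \/ coord (xi (w (map Z ts))) (inr u) -> range Z u.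
  move=> [] /asboolP[/bP[m <-] _]; first by exists (GenTree.Leaf m).
  by exists (GenTree.Node m ts).
rewrite /box/=; elim: l {tsH H} => //= -[p|u] l IH.
  exact: IH.
have [Zu|nZu] := pselect (range Z u).
  by rewrite /= asboolT//= => /andP[-> ?] /=; exact: IH.
rewrite /= asboolF// => /IH ->; rewrite andbT; apply/eqP.
transitivity false.
  by apply/negbTE/negP => ux; apply: nZu; apply: ZP; right.
by apply/esym/negbTE/negP => ux; apply: nZu; apply: ZP; left.
Qed.

Lemma space_countably_tight : @countably_tight X.
Proof.
move=> A q clA; suff : closure ((A `&` \bigcup_n range (incl n)) `|` (A `&` range xi)) q.
  by rewrite closureU => -[/incl_part_tight|/xi_part_tight].
apply: closure_subset clA => r Ar.
by have [[n [c rE]]|[t rE]] := ptsP r; [left|right]; split=> //; rewrite rE;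
  [exists n => //; exists c|exists t].
Qed.

Lemma space_ct_zd_T2 : @ct_zd_T2 X.
Proof.
split; [exact: space_countably_tight|exact: trace_zero_dim|].
exact/trace_hausdorff/coord_inj.
Qed.

End Space.

(** * Enumerating the tasks in type omega_1 *)

Local Notation R := Rdefinitions.R.

Section Ternary.
Local Open Scope ring_scope.

(** Base 3 rather than 2 makes the limit injective: the tail after a position sums to at most half
    the weight of that position. *)
Definition ternary (x : nat -> bool) (n : nat) : R := \sum_(i < n) (x i)%:R / 3 ^+ i.

Lemma ternary_le x m n : (m <= n)%N ->
  ternary x n <= ternary x m + 3 / 2 * (1 / 3 ^+ m - 1 / 3 ^+ n).
Proof.
elim: n => [|n IH].
  by rewrite leqn0 => /eqP->; rewrite subrr mulr0 addr0.
rewrite leq_eqVlt => /predU1P[->|]; first by rewrite subrr mulr0 addr0.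
rewrite ltnS => /IH{}IH; rewrite /ternary big_ord_recr/=.
have p3 : 0 < 1 / 3 ^+ n :> R by rewrite divr_gt0// exprn_gt0.
have -> : (x n)%:R / 3 ^+ n = (x n)%:R * (1 / 3 ^+ n) :> R by rewrite mul1r.
have -> : 1 / 3 ^+ n.+1 = 1 / 3 ^+ n / 3 :> R.
  by rewrite !mul1r exprS invfM mulrC.
have : (x n)%:R * (1 / 3 ^+ n) <= 1 / 3 ^+ n :> R.
  by case: (x n); rewrite ?mul1r// mul0r ltW//; rewrite mul1r in p3.
move: IH; rewrite /ternary; lra.
Qed.

Definition ternary_sup x : R := sup (range (ternary x)).

Lemma ternary_has_sup x : has_sup (range (ternary x)).
Proof.
split; first by exists (ternary x 0), 0%N.
exists (3 / 2) => _ [n _ <-]; apply: (le_trans (ternary_le x (leq0n n))).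
have : 0 < 1 / 3 ^+ n :> R by rewrite divr_gt0// exprn_gt0.
by rewrite /ternary big_ord0 expr0; lra.
Qed.

Lemma ternary_sup_inj : injective ternary_sup.
Proof.
suff lt_sup x y m : (forall i, (i < m)%N -> x i = y i) -> ~~ x m -> y m ->
    ternary_sup x < ternary_sup y.
  move=> x y exy; apply/funext; apply: contrapT => /existsNP[k /eqP nxyk].
  have [m nxym mmin] := ex_minnP (ex_intro (fun k => x k != y k) k nxyk).
  have xy i : (i < m)%N -> x i = y i.
    by move=> im; apply/eqP/negPn/negP => /mmin; rewrite leqNgt im.
  case xm: (x m) nxym => nxym; case ym: (y m) nxym => // _.
    have := @lt_sup y x m (fun i im => esym (xy i im)); rewrite exy ltxx xm ym.
    by move=> /(_ isT isT).
  by have := @lt_sup x y m xy; rewrite exy ltxx xm ym => /(_ isT isT).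
move=> xy /negbTE xm ym; apply: (@lt_le_trans _ _ (ternary y m.+1)); last first.
  by apply: sup_upper_bound; [exact: ternary_has_sup|exists m.+1].
have sxy : ternary x m = ternary y m.
  by apply: eq_bigr => i _; rewrite xy.
(* At the first difference [m] only [y] has a digit; the later digits of [x] add at most [1 / 2] of
   its weight [1 / 3 ^+ m]. *)
apply: (@le_lt_trans _ _ (ternary x m + 1 / 2 * (1 / 3 ^+ m))).
  apply: ge_sup; first by exists (ternary x 0), 0%N.
  move=> _ [n _ <-].
  have pm k : 0 < 1 / 3 ^+ k :> R by rewrite divr_gt0// exprn_gt0.
  have [nm|mn] := leqP n m.
    apply: (@le_trans _ _ (ternary x m)); last by have := pm m; lra.
    rewrite /ternary -(subnKC nm) big_split_ord/= lerDl; apply: sumr_ge0 => i _.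
    by apply: divr_ge0; rewrite ?exprn_ge0// ler0n.
  apply: (le_trans (ternary_le x mn)); rewrite {1}/ternary big_ord_recr/= xm mul0r.
  have -> : 1 / 3 ^+ m.+1 = 1 / 3 ^+ m / 3 :> R by rewrite !mul1r exprS invfM mulrC.
  by have := pm n; rewrite /ternary; lra.
rewrite sxy {2}/ternary big_ord_recr/= ym mulr1n.
have : 0 < 1 / 3 ^+ m :> R by rewrite divr_gt0// exprn_gt0.
rewrite /ternary; lra.
Qed.
End Ternary.

Definition injects (T T' : Type) : Prop := exists g : T -> T', injective g.

(** CH is applied to the image of [S] in the reals. If this image is equipotent to the reals, [T]
    goes into the reals, by a bijection onto the image, and back to [S]. *)
Lemma CH_dichotomy (T : Type) : CH -> injects T R ->
  forall S : set T, countable S \/ exists2 g : T -> T, injective g & range g `<=` S.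
Proof.
move=> ch [e einj] S; have [cS|eS] := ch (e @` S); [left|right].
  have /countable_injP[r rinj] := cS.
  apply/countable_injP; exists (r \o e) => s t; rewrite !inE => Ss St rst.
  by apply/einj/rinj => //; rewrite inE; [exists s|exists t].
have /card_set_bijP[h [hfun hinj _]] : ([set: R] #= e @` S)%card by rewrite card_eq_sym.
have /choice[g gP] t : exists s, S s /\ e s = h (e t).
  by have [s Ss es] := hfun (e t) I; exists s.
exists g; last by move=> _ [t _ <-]; have [] := gP t.
move=> s t gst; apply/einj/hinj; rewrite ?inE//.
by rewrite -(proj2 (gP s)) -(proj2 (gP t)) gst.
Qed.

(** Take a well-order. If some initial segment is uncountable, [T] embeds in the least such segment,
    whose own initial segments are all countable, and the order is pulled back along the
    embedding. *)
Lemma omega1_order (T : choiceType) :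
  (forall S : set T, countable S \/ exists2 g : T -> T, injective g & range g `<=` S) ->
  exists lt : T -> T -> Prop,
    [/\ well_founded lt, forall u v w, lt u v -> lt v w -> lt u w,
        forall u v, lt u v \/ u = v \/ lt v u &
        forall t, countable [set u | lt u t]].
Proof.
move=> dich; have [W Wwo] := well_ordering_principle T.
have Wmin (S : set T) : S !=set0 -> exists2 z, S z & forall y, S y -> W z y.
  move=> [s Ss]; have [|z [[/asboolP Sz lbz] _]] := Wwo (fun x => `[< S x >]).
    by exists s; apply/asboolP.
  by exists z => // y Sy; apply: lbz; apply/asboolP.
have Wtot u v : W u v \/ W v u.
  have [|z [->|->] zmin] := Wmin [set u; v]; first by exists u; left.
    by left; apply: zmin; right.
  by right; apply: zmin; left.
have Wanti u v : W u v -> W v u -> u = v.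
  move=> uv vu; have [|z [_ zu]] := Wwo (fun x => `[< x = u \/ x = v >]).
    by exists u; apply/asboolP; left.
  have Wr x : W x x by have [] := Wtot x x.
  rewrite -(zu u) ?(zu v)//; split.
  - by apply/asboolP; right.
  - by move=> x /asboolP[->|->].
  - by apply/asboolP; left.
  - by move=> x /asboolP[->|->].
pose lt0 u v := W u v /\ u <> v.
have lt0_total u v : lt0 u v \/ u = v \/ lt0 v u.
  have [->|uv] := pselect (u = v); first by right; left.
  by have [Wuv|Wvu] := Wtot u v; [left|right; right; split=> // /esym].
have lt0_irr u v : lt0 u v -> ~ W v u by move=> [uv nuv] /(Wanti _ _ uv).
have lt0_wf : well_founded lt0.
  move=> t; apply: contrapT => nt.
  have [|z nz zmin] := Wmin [set u | ~ Acc lt0 u]; first by exists t.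
  apply: nz; constructor=> y /lt0_irr nzy; apply: contrapT => ny.
  by apply: nzy; exact: zmin.
have lt0_trans u v w : lt0 u v -> lt0 v w -> lt0 u w.
  move=> uv vw; have [|z] := Wmin [set x | x = u \/ x = v \/ x = w].
    by exists u; left.
  move=> + zmin; have zu := zmin u (or_introl erefl).
  have zv := zmin v (or_intror (or_introl erefl)).
  have zw := zmin w (or_intror (or_intror erefl)).
  move=> [zE|[zE|zE]]; subst z.
  - by split=> // uw; subst w; exact: (lt0_irr _ _ vw) (proj1 uv).
  - by exfalso; exact: (lt0_irr _ _ uv).
  - by exfalso; exact: (lt0_irr _ _ vw).
have [g ginj gcount] : exists2 g : T -> T, injective g &
    forall t, countable [set u | lt0 u (g t)].
  have [allc|/existsNP[t nct]] := pselect (forall t, countable [set u | lt0 u t]).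
    by exists id.
  have [|z nz zmin] := Wmin [set t | ~ countable [set u | lt0 u t]]; first by exists t.
  have [//|[g ginj gz]] := dich [set u | lt0 u z].
  exists g => // s; apply: contrapT => ns.
  by apply: (lt0_irr _ _ (gz _ (ex_intro2 _ _ s I erefl))); exact: zmin.
exists (fun u v => lt0 (g u) (g v)); split.
- move=> t; have [s] := ex_intro (fun s => s = g t) _ erefl.
  elim: (lt0_wf s) t => {}s _ IH t st; constructor=> u; rewrite -st => us.
  exact: (IH _ us).
- by move=> u v w; exact: lt0_trans.
- by move=> u v; have [|[/ginj|]] := lt0_total (g u) (g v); auto.
- move=> t; have /countable_injP[r rinj] := gcount t.
  apply/countable_injP; exists (r \o g) => u v; rewrite !inE/= => ut vt ruv.
  by apply/ginj/rinj => //; rewrite inE.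
Qed.

Lemma uncountable_bool_seq (h : (nat -> bool) -> nat) : ~ injective h.
Proof.
move=> hinj; pose d n := ~~ xget (fun=> false) [set y | h y = n] n.
have dE : xget (fun=> false) [set y | h y = h d] = d.
  by apply: hinj; exact: (xgetPex _ (ex_intro (fun y => h y = h d) d erefl)).
have : d (h d) = ~~ d (h d) by rewrite {1}/d dE.
by case: (d _).
Qed.

(** * The construction for a given notion of selection *)

(* Sequences of closed and of open sets, coded by lists of cylinders. *)
Local Notation task :=
  ((nat -> seq (nat * bool) -> bool) * (nat -> seq (nat * bool) -> bool))%type.

Definition task_closed (t : task) n : set cantor :=
  [set c | forall s, t.1 n s -> ~ cylinder s c].

Definition task_open (t : task) n : set cantor :=
  [set c | exists2 s, t.2 n s & cylinder s c].

Lemma cylinder_open s : open (cylinder s).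
Proof.
rewrite openE => c cs; exists [seq p.1 | p <- s] => d.
move: cs; rewrite /box/cylinder/= all_map /preim/=.
by elim: s => //= p s IH /andP[/eqP -> /IH{}IH] /andP[/eqP -> /IH ->]; rewrite eqxx.
Qed.

Lemma open_cylinder (V : set cantor) c : open V -> V c ->
  exists2 s, cylinder s c & cylinder s `<=` V.
Proof.
rewrite openE => oV /oV[l lV]; exists [seq (i, c i) | i <- l];
  by rewrite cylinder_box //; exact: box_refl.
Qed.

Lemma task_open_open t n : open (task_open t n).
Proof.
rewrite (_ : task_open t n = \bigcup_(s in [set s | t.2 n s]) cylinder s).
  by apply: bigcup_open => s _; exact: cylinder_open.
by apply/seteqP; split=> c [s]; exists s.
Qed.

Lemma task_open_surj (V : nat -> set cantor) : (forall n, open (V n)) ->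
  exists t, task_open t = V.
Proof.
move=> oV; exists (fun _ _ => false, fun n s => `[< cylinder s `<=` V n >]).
apply/funext => n; apply/seteqP; split=> [c [s /asboolP sV /sV//]|c Vc].
by have [s sc sV] := open_cylinder (oV n) Vc; exists s => //; apply/asboolP.
Qed.

Lemma task_closed_surj (A : nat -> set cantor) : (forall n, closed (A n)) ->
  exists p, forall q, task_closed (p, q) = A.
Proof.
move=> cA; exists (fun n s => `[< cylinder s `<=` ~` A n >]) => q.
apply/funext => n; apply/seteqP; split=> c /=.
  move=> H; apply: contrapT => nAc.
  have [s sc sA] := open_cylinder (closed_openC (cA n)) nAc.
  by apply: (H s) => //; apply/asboolP.
by move=> Ac s /asboolP sA /sA.
Qed.

Lemma task_injects : injects task R.
Proof.
pose enc (t : task) (m : nat) : bool :=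
  if unpickle m is Some (b, (n, s)) then if (b : bool) then t.1 n s else t.2 n s else false.
exists (ternary_sup \o enc) => -[p q] [p' q'] /ternary_sup_inj e.
have e' (b : bool) (n : nat) (s : seq (nat * bool)) : enc (p, q) (pickle (b, (n, s))) = enc (p', q') (pickle (b, (n, s))).
  by rewrite e.
by congr pair; apply/funext => n; apply/funext => s;
  [have := e' true n s|have := e' false n s]; rewrite /enc pickleK.
Qed.

(** The construction sees the notion of selection only through [bad] and [good], so the four spaces
    arise from four choices of these classes. *)
Theorem selective_space (bad good : set (set cantor)) : CH ->
  (forall A, bad A -> closed A) ->
  (forall V k, open V -> V !=set0 -> exists F, [/\ good F, F `<=` V & big bad k F]) ->
  exists (X : topologicalType) (i : nat -> cantor -> X),
    [/\ @ct_zd_T2 X,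
        forall n, [/\ continuous (i n), forall V, open V -> open (i n @` V) &
                      closed (range (i n))],
        forall n m c d, i n c = i m d -> n = m /\ c = d,
        forall W : nat -> set X, (forall n, open (W n)) -> (forall n, W n !=set0) ->
          exists (A : nat -> set cantor) (k : nat -> nat),
            (forall n, good (A n) /\ i (k n) @` A n `<=` W n) /\
            exists q, accumulation_point_family (fun n => i (k n) @` A n) q &
        forall (A : nat -> set cantor) q, (forall n, bad (A n)) ->
          ~ accumulation_point_family (fun n => i n @` A n) q].
Proof.
move=> ch bad_closed good_big.
have [lt [lt_wf lt_trans lt_total lt_countable]] :=
  omega1_order (CH_dichotomy ch task_injects).
(* Uncountably many tasks share their first component, so they occur arbitrarily late. *)
have cofinal (A : nat -> set cantor) (t : task) : (forall n, closed (A n)) -> exists2 u, task_closed u = A & ~ lt u t.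
  move=> /task_closed_surj[p pA]; apply: contrapT => H.
  have lt_t (q : nat -> seq (nat * bool) -> bool) : lt (p, q) t by apply: contrapT => nlt; apply: H; exists (p, q).
  have /countable_injP[r rinj] := lt_countable t.
  apply: (@uncountable_bool_seq (fun x => r (p, fun n _ => x n))) => x y rxy.
  have [] : (p, fun n (_ : seq (nat * bool)) => x n) = (p, fun n _ => y n).
    by apply: rinj => //; rewrite inE; exact: lt_t.
  by move=> e; apply/funext => n; exact: (congr1 (fun g => g n [::]) e).
have [f fP] := construction ((fun=> false) : cantor) task_closed lt_wf lt_countable
  task_open_open good_big.
have /choice[U UP] (t : task) := free_ultrafilter [set n | task_open t n !=set0].
have f_clopen (t : task) n : clopen ((f t).2 n) by have [] := fP t.
have f_stage (t : task) : stage bad good lt task_closed task_open f t (f t) by have [] := fP t.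
have U_ultra (t : task) : UltraFilter (U t) by have [] := UP t.
have U_infinite (t : task) S : U t S -> infinite_set S by have [_ + _] := UP t; apply.
have U_active (t : task) : infinite_set [set n | task_open t n !=set0] ->
  U t [set n | task_open t n !=set0] by have [] := UP t.
exists (trace_space (@coord _ lt f U)), (@incl _ lt f U); split.
- exact: space_ct_zd_T2.
- move=> n; split; [exact: incl_continuous|exact: incl_open|exact: range_incl_closed].
- exact: incl_inj.
- move=> W; exact: (good_selectors lt_trans lt_total task_open_surj good_big
    f_clopen f_stage U_ultra U_infinite U_active).
- move=> A q; exact: (bad_selectors cofinal bad_closed f_stage).
Qed.

(** * The four notions of selection *)

Definition cyl (c : cantor) n : set cantor :=
  [set d | forall i, i < n -> d i = c i].

Lemma cyl_clopen c n : clopen (cyl c n).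
Proof.
rewrite (_ : cyl c n = box (@id (nat -> bool)) c (iota 0 n)).
  by split; [exact: box_open|exact: box_closed].
apply/seteqP; split=> d; rewrite /cyl/box/= => H.
  by apply/allP => i; rewrite mem_iota add0n => /H ->.
by move=> i ni; apply/eqP; move/allP : H; apply; rewrite mem_iota.
Qed.

Lemma nbhs_cyl (c : cantor) (N : set cantor) : nbhs c N -> exists n, cyl c n `<=` N.
Proof.
move=> [l lN]; exists (\max_(i <- l) i).+1 => d dc; apply: lN.
apply/allP => i il; apply/eqP; apply: dc.
by rewrite ltnS (big_rem i)//= leq_maxl.
Qed.

Lemma clopen_setC (X : topologicalType) (A : set X) : clopen A -> clopen (~` A).
Proof. by move=> [oA cA]; split; [exact: closed_openC|exact: open_closedC]. Qed.

(** The points that first leave [c] at position [n]. For fixed [c] these clopen sets are disjoint,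
    cover everything except [c], and converge to [c]. *)
Definition branch (c : cantor) n : set cantor := cyl c n `&` [set d | d n = ~~ c n].

Lemma branch_clopen c n : clopen (branch c n).
Proof.
apply: clopenI; first exact: cyl_clopen.
by split; [exact: (@trace_open_coord nat (nat -> bool) id)|
  exact: (@trace_closed_coord nat (nat -> bool) id)].
Qed.

Lemma branch_nonempty c n : branch c n !=set0.
Proof.
exists (fun i => if i == n then ~~ c i else c i); split => [i|]/=.
  by move=> /ltn_eqF ->.
by rewrite eqxx.
Qed.

Lemma branch_disjoint c n m d : branch c n d -> branch c m d -> n = m.
Proof.
move=> [dn nd] [dm md]; have [nm|mn|//] := ltngtP n m.
  by move: nd; rewrite /= dm//; case: (c n).
by move: md; rewrite /= dn//; case: (c m).
Qed.

Lemma finite_set_missed (X : Type) (A : set X) (S : nat -> set X) :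
  finite_set A -> (forall n m x, S n x -> S m x -> n = m) ->
  exists N, forall n, N <= n -> S n `&` A = set0.
Proof.
move=> Afin Sdisj.
pose r x := xget 0 [set n | S n x].
have [M rM] : exists M, forall x, A x -> r x <= M.
  have /finite_setP[k /card_esym/card_set_bijP[h [hf _ hs]]] := finite_image r Afin.
  exists (\max_(i < k) h i) => x Ax.
  have [i /= ik <-] := hs (r x) (ex_intro2 _ _ x Ax erefl).
  exact: (leq_bigmax (Ordinal ik)).
exists M.+1 => n Mn; apply/seteqP; split=> // x [Snx Ax].
have Sr : S (r x) x by exact: (xgetPex 0 (ex_intro (fun n => S n x) n Snx)).
by move: Mn; rewrite -(Sdisj _ _ _ Sr Snx) ltnNge rM.
Qed.

(* A bad set missing one branch is separated from it by the complement of the branch. *)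
Lemma big_branches bad k c (I : set nat) (F : nat -> set cantor) :
  I !=set0 -> (forall n, F n `<=` branch c n) -> (forall n, big bad k (F n)) ->
  (forall A, bad A -> exists2 n, I n & branch c n `&` A = set0) ->
  big bad k.+1 (\bigcup_(n in I) F n).
Proof.
move=> [m Im] Fbr Fbig miss; split; first by apply: big_sub (Fbig m) => d; exists m.
move=> A /miss[n In nA]; exists (~` branch c n); split.
- exact/clopen_setC/branch_clopen.
- by move=> d Ad nd; have : set0 d by rewrite -nA.
- by apply: big_sub (Fbig n) => d Fd; split; [exists n|apply; exact: Fbr].
Qed.

Lemma branches_near c (V : set cantor) : open V -> V c ->
  exists m, forall n, m <= n -> branch c n `<=` V.
Proof.
rewrite openE => oV /oV /nbhs_cyl[m mV]; exists m => n mn d [dn _].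
by apply: mV => i im; apply: dn; exact: leq_trans im mn.
Qed.

(** Sets of rank [k] in two disjoint branches together have rank [k.+1], because a single point
    misses one of the branches; [F] is a finite binary tree of points. *)
Lemma finite_big (V : set cantor) k : open V -> V !=set0 ->
  exists F, [/\ finite_set F, F `<=` V & big (@singletons cantor) k F].
Proof.
elim: k V => [|k IH] V oV [c Vc].
  by exists [set c]; split; [exact: finite_set1|move=> _ ->|exists c].
have [m mV] := branches_near oV Vc.
have /choice[F FP] n := IH (branch c n) (proj1 (branch_clopen c n)) (branch_nonempty c n).
exists (\bigcup_(n in [set m; m.+1]) F n); split.
- by apply: bigcup_finite; [exact: finite_set2|move=> n _; have [] := FP n].
- move=> d [n nm Fd]; apply: (mV n); first by case: nm => ->.
  by have [_ + _] := FP n; apply.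
- apply: (big_branches (c := c)).
  + by exists m; left.
  + by move=> n; have [] := FP n.
  + by move=> n; have [] := FP n.
  + move=> _ [x ->]; have [mx|mx] := pselect (branch c m x).
      exists m.+1; first by right.
      apply/seteqP; split=> // y [my yx]; rewrite yx in my.
      by have := branch_disjoint mx my => /eqP; rewrite eqn_leq ltnn andbF.
    by exists m; [left|apply/seteqP; split=> // y [my yx]; apply: mx; rewrite -yx].
Qed.

Lemma neq_branch (c d : cantor) : d <> c -> exists n, branch c n d.
Proof.
move=> dc; have [k ck] : exists k, d k != c k.
  by apply: contrapT => /forallNP H; apply: dc; apply/funext => k; apply/eqP/negPn/negP/H.
have [n dn nmin] := ex_minnP (ex_intro (fun k => d k != c k) k ck).
exists n; split=> [i ni|/=]; last by case: (d n) (c n) dn => -[].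
by apply/eqP/negPn/negP => /nmin; rewrite leqNgt ni.
Qed.

(** Infinitely many branches converging to [c] replace the two, since a finite set misses almost all
    of them. Adding [c] makes the union of the chosen sets closed. *)
Lemma closed_scattered_big (V : set cantor) k : open V -> V !=set0 ->
  exists F, [/\ closed F /\ scattered F, F `<=` V & big finite_set k F].
Proof.
elim: k V => [|k IH] V oV [c Vc].
  exists [set c]; split; [|by move=> _ ->|by exists c].
  split.
    apply: compact_closed; last exact: compact_set1.
    by apply: trace_hausdorff => x y.
  move=> B Bc [x Bx]; exists x => //; exists setT; split; first exact: openT.
  by rewrite setTI; apply/seteqP; split=> [y /Bc ->|_ ->//]; rewrite (Bc x).
have [m mV] := branches_near oV Vc.
have /choice[F FP] n := IH (branch c n) (proj1 (branch_clopen c n)) (branch_nonempty c n).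
have Fbr n : F n `<=` branch c n by have [] := FP n.
exists ([set c] `|` \bigcup_(n in [set n | m <= n]) F n); split.
- split.
    move=> d cld; have [->|/neq_branch[n dn]] := pselect (d = c); first by left.
    have br_nbhs : nbhs d (branch c n).
      by apply: open_nbhs_nbhs; split => //; have [] := branch_clopen c n.
    have [mn|nm] := leqP m n.
      right; exists n => //; have [[cF _] _ _] := FP n; apply: cF => N Nd.
      have [e [[->|[n' mn' Fe]] [Ne ne]]] := cld (N `&` branch c n) (filterI Nd br_nbhs).
        by case: ne => _ /=; case: (c n).
      by exists e; split => //; rewrite (branch_disjoint ne (Fbr _ _ Fe)).
    have [e [[->|[n' /= mn' /Fbr Fe]] ne]] := cld (branch c n) br_nbhs.
      by case: ne => _ /=; case: (c n).
    by move: nm; rewrite (branch_disjoint ne Fe) ltnNge mn'.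
  (* If [B] has a point other than [c], an isolated point of its trace on a clopen branch is
     isolated in [B]; otherwise [c] is the only point of [B]. *)
  move=> B BF [b Bb]; have [[d [Bd dc]]|Bc] := pselect (exists d, B d /\ d <> c).
    have [dc'|[n mn Fd]] := BF d Bd; first by case: (dc dc').
    have [||e [Be ne] [W [oW WE]]] := proj2 (let: And3 h _ _ := FP n in h) (B `&` branch c n).
    - move=> e [Be ne]; have [ec|[n' _ Fe]] := BF e Be.
        by case: ne => _ /=; rewrite ec; case: (c n).
      by rewrite (branch_disjoint ne (Fbr _ _ Fe)).
    - by exists d; split=> //; exact: Fbr.
    exists e => //; exists (W `&` branch c n); split; last by rewrite -setIA (setIC _ B).
    by apply: openI => //; have [] := branch_clopen c n.
  have Bc' d : B d -> d = c by move=> Bd; apply: contrapT => dc; apply: Bc; exists d.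
  exists b => //; exists setT; split; first exact: openT.
  rewrite setTI; apply/seteqP; split=> [d /Bc' ->|_ ->//].
  by rewrite (Bc' b).
- move=> d [->//|[n mn /Fbr]]; exact: mV.
- suff : big finite_set k.+1 (\bigcup_(n in [set n | m <= n]) F n).
    by apply: big_sub => d; right.
  apply: (big_branches (c := c)) => //.
  + by exists m => /=.
  + by move=> n; have [] := FP n.
  + move=> A /finite_set_missed/(_ (@branch_disjoint c))[N NP].
    by exists (maxn m N); [exact: leq_maxl|apply: NP; exact: leq_maxr].
Qed.

Definition crowded (Q : set cantor) : Prop :=
  forall d n, Q d -> exists e, [/\ Q e, cyl d n e & e <> d].

Lemma crowded_not_scattered (Q A : set cantor) :
  crowded Q -> Q !=set0 -> scattered A -> ~ Q `<=` A.
Proof.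
move=> Qcr Q0 Asc /Asc/(_ Q0)[x Qx [V [oV VQ]]].
have [Vx _] : (V `&` Q) x by rewrite VQ.
have [n nV] : exists n, cyl x n `<=` V by apply: nbhs_cyl; exact: open_nbhs_nbhs.
have [e [Qe ne]] := Qcr x n Qx; apply.
have : (V `&` Q) e by split=> //; exact: nV.
by rewrite VQ.
Qed.

(** A closed scattered [A] cannot contain [Q], so some cylinder around a point of [Q] misses [A].
    Inside this cylinder [Q] is still crowded and in the closure of [S], and the argument
    repeats. *)
Lemma crowded_closure_big (S Q : set cantor) k :
  Q `<=` closure S -> crowded Q -> Q !=set0 ->
  big (@closed_scattered_subsets cantor) k S.
Proof.
elim: k S Q => [|k IH] S Q QS Qcr Q0.
  by have [q /QS Sq] := Q0; have [|y [Sy _]] := Sq setT; [exact: filterT|exists y].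
split; first exact: IH QS Qcr Q0.
move=> A [cA sA].
have /existsNP[q /not_implyP[Qq nAq]] := crowded_not_scattered Qcr Q0 sA.
have [n nA] : exists n, cyl q n `<=` ~` A.
  by apply: nbhs_cyl; apply: open_nbhs_nbhs; split=> //; exact: closed_openC.
exists (~` cyl q n); split.
- exact/clopen_setC/cyl_clopen.
- by move=> x Ax /nA.
- apply: (IH _ (Q `&` cyl q n)).
  + move=> x [/QS Sx nx] N Nx; have [|y [Sy [Ny ny]]] := Sx (N `&` cyl q n).
      apply: filterI => //; apply: open_nbhs_nbhs; split=> //.
      by have [] := cyl_clopen q n.
    by exists y; split=> //; split=> // /(_ ny).
  + move=> x m [Qx nx]; have [e [Qe me ex]] := Qcr x (maxn m n) Qx.
    exists e; split=> //.
      split=> // i ni; rewrite -nx//; apply: me; exact: leq_trans ni (leq_maxr _ _).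
    by move=> i im; apply: me; exact: leq_trans im (leq_maxl _ _).
  + by exists q; split.
Qed.

(** A relatively discrete set can have a crowded set in its closure and then has every rank: even
    positions isolate the points of [F], odd ones let the points of [Q] vary. *)
Lemma scattered_big (V : set cantor) k : open V -> V !=set0 ->
  exists F, [/\ scattered F, F `<=` V & big (@closed_scattered_subsets cantor) k F].
Proof.
move=> oV [c Vc]; have [n0 n0V] : exists n, cyl c n `<=` V.
  by apply: nbhs_cyl; exact: open_nbhs_nbhs.
(* The last [true] of a point of [F] is its first one at an even position from [n0]
   on; the points of [Q] are [false] at all these positions. *)
pose F : set cantor := [set d | cyl c n0 d /\ exists m, [/\ n0 <= m, ~~ odd m, d m,
  forall j, m < j -> d j = false & forall j, n0 <= j -> j < m -> ~~ odd j -> d j = false]].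
pose Q : set cantor :=
  [set d | cyl c n0 d /\ forall j, n0 <= j -> ~~ odd j -> d j = false].
exists F; split; last apply: (@crowded_closure_big _ Q).
- move=> B BF [d Bd]; exists d => //.
  have [dc [m [n0m om dm d0 dlow]]] := BF d Bd.
  exists (cyl d m.+1); split; first by have [] := cyl_clopen d m.+1.
  apply/seteqP; split=> [e [ed Be]|_ ->]; last by split.
  have [_ [m' [n0m' om' em' e0 elow]]] := BF e Be.
  have mm' : m = m'.
    have [mm'|m'm|//] := ltngtP m m'.
      by have := elow m n0m mm' om; rewrite (ed m)// dm.
    by have := dlow m' n0m' m'm om'; rewrite -(ed m') ?em'// ltnW.
  apply/funext => i; have [im|mi] := leqP i m; first exact: ed.
  by rewrite d0// e0// -mm'.
- by move=> d [dc _]; exact: n0V.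
- move=> d [dc dQ] N /nbhs_cyl[n nN]; pose m := (maxn n n0).*2.
  have nm : n <= m by rewrite /m -addnn (leq_trans (leq_maxl n n0))// leq_addr.
  have n0m : n0 <= m by rewrite /m -addnn (leq_trans (leq_maxr n n0))// leq_addr.
  have em : ~~ odd m by rewrite odd_double.
  exists (fun j => if j < m then d j else j == m); split; last first.
    by apply: nN => i ni; rewrite (leq_trans ni nm).
  split; first by move=> i ni; rewrite (leq_trans ni n0m); exact: dc.
  exists m; split=> //; first by rewrite ltnn eqxx.
    by move=> j mj; rewrite ltnNge (ltnW mj)/= gtn_eqF.
  by move=> j n0j jm oj; rewrite jm; exact: dQ.
(* Flipping an odd position beyond [n] and [n0] does not leave [Q]. *)
- move=> d n [dc dQ]; pose m := (maxn n n0).*2.+1.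
  have nm : n <= m by rewrite /m -addnn (leq_trans (leq_maxl n n0))// -addnS leq_addr.
  have n0m : n0 <= m by rewrite /m -addnn (leq_trans (leq_maxr n n0))// -addnS leq_addr.
  exists (fun j => if j == m then ~~ d j else d j); split.
  + split=> [i ni|j n0j oj]; first by rewrite ltn_eqF ?(leq_trans ni n0m)//; exact: dc.
    case: eqP => [jm|_]; last exact: dQ.
    by move: oj; rewrite jm /= odd_double.
  + by move=> i ni; rewrite ltn_eqF// (leq_trans ni nm).
  + by move=> /(congr1 (@^~ m)); rewrite /= eqxx; case: (d m).
- exists (fun j => if j < n0 then c j else false); split.
    by move=> i ni; rewrite ni.
  by move=> j n0j _; rewrite ltnNge n0j.
Qed.

(** A closed set with empty interior misses some cylinder inside [V], and this cylinder is again
    open and non-empty; so open sets have every rank. *)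
Lemma open_big (V : set cantor) k : open V -> V !=set0 ->
  exists F : set cantor, [/\ setT F, F `<=` V &
    big [set A | closed A /\ interior A = set0] k F].
Proof.
move=> oV V0; exists V; split => //.
suff H S : V `<=` S -> big [set A | closed A /\ interior A = set0] k S by exact: H.
elim: k V oV V0 S => [|k IH] V oV V0 S VS; first by have [x /VS] := V0; exists x.
split; first exact: IH VS.
move=> A [cA iA]; have [q [Vq nAq]] : (V `&` ~` A) !=set0.
  apply: contrapT => VA; have [x Vx] := V0; suff : set0 x by [].
  rewrite -iA; apply: (filterS _ (open_nbhs_nbhs (conj oV Vx))) => y Vy.
  apply: contrapT => nAy.
  by apply: VA; exists y.
have [n nV] : exists n, cyl q n `<=` V `&` ~` A.
  apply: nbhs_cyl; apply: open_nbhs_nbhs; split=> //.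
  by apply: openI => //; exact: closed_openC.
exists (~` cyl q n); split.
- exact/clopen_setC/cyl_clopen.
- by move=> x Ax /nV[].
- apply: (IH (cyl q n)); [by have [] := cyl_clopen q n|by exists q|].
  by move=> x nx; split=> [|//]; apply: VS; have [] := nV x nx.
Qed.

(** * Transfer of sets along a clopen embedding *)

Section Transfer.
Variables (X : topologicalType) (e : cantor -> X).
Hypothesis e_inj : injective e.
Hypothesis e_continuous : continuous e.
Hypothesis e_open : forall V, open V -> open (e @` V).
Hypothesis e_range : closed (range e).

Lemma image_closed (F : set cantor) : closed F -> closed (e @` F).
Proof.
move=> cF; rewrite (_ : e @` F = range e `&` ~` (e @` (~` F))).
  by apply: closedI => //; apply/open_closedC/e_open/closed_openC.
apply/seteqP; split=> [_ [c Fc <-]|_ [[c _ <-] nF]].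
  by split; [exists c|move=> [d nFd /e_inj dc]; apply: nFd; rewrite dc].
by exists c => //; apply: contrapT => nFc; apply: nF; exists c.
Qed.

Lemma image_scattered (F : set cantor) : scattered F -> scattered (e @` F).
Proof.
move=> sF B BF [b Bb].
have eF c : B (e c) -> F c by move=> /BF[d Fd /e_inj <-].
have [c Fc cb] := BF b Bb.
have [|x Bx [V [oV VB]]] := sF (e @^-1` B) eF; first by exists c; rewrite /= cb.
exists (e x) => //; exists (e @` V); split; first exact: e_open.
apply/seteqP; split=> [_ [[y Vy <-] By]|_ ->].
  by have : (V `&` e @^-1` B) y by []; rewrite VB => ->.
have [Vx _] : (V `&` e @^-1` B) x by rewrite VB.
by split=> //; exists x.
Qed.

Lemma preimage_closed (A : set X) : closed A -> closed (e @^-1` A).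
Proof. by move=> cA; apply: closed_comp => // c _; exact: e_continuous. Qed.

Lemma preimage_scattered (A : set X) : scattered A -> scattered (e @^-1` A).
Proof.
move=> sA B BA [b Bb].
have [||_ [x Bx <-] [V [oV VB]]] := sA (e @` B).
- by move=> _ [c /BA ? <-].
- by exists (e b), b.
exists x => //; exists (e @^-1` V); split.
  by apply: open_comp => // c _; exact: e_continuous.
apply/seteqP; split=> [y [Vy By]|_ ->].
  apply: e_inj; have : (V `&` e @` B) (e y) by split=> //; exists y.
  by rewrite VB.
have [Vx _] : (V `&` e @` B) (e x) by rewrite VB.
by split.
Qed.

Lemma preimage_nowhere_dense (A : set X) :
  nowhere_dense A -> interior (closure (e @^-1` A)) = set0.
Proof.
move=> nA; apply/seteqP; split=> // c.
rewrite /interior/= nbhsE => -[V [oV Vc] VA].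
suff : (interior (closure A)) (e c) by rewrite nA.
rewrite /interior/= nbhsE; exists (e @` V); first by split; [exact: e_open|exists c].
move=> _ [d Vd <-] N Nd; have [y [Ay Ny]] := VA d Vd _ (@e_continuous d N Nd).
by exists (e y).
Qed.
End Transfer.

Lemma preimage_image_sub (X : Type) (e : cantor -> X) (A : set X) :
  A `<=` range e -> e @` (e @^-1` A) = A.
Proof.
move=> Ae; apply/seteqP; split=> [_ [c Ac <-]//|x Ax].
by have [c _ cx] := Ae x Ax; exists c => //=; rewrite cx.
Qed.

Lemma accumulation_point_mono (X : topologicalType) (A B : nat -> set X) (x : X) :
  (forall n, A n `<=` B n) ->
  accumulation_point_family A x -> accumulation_point_family B x.
Proof.
move=> AB acc N /acc; apply: sub_infinite_set => n [y [Ay Ny]].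
by exists y; split=> //; exact: AB.
Qed.

Section Selection.
Variables (bad good : set (set cantor)) (calA calB : forall X : topologicalType, set (set X)).
Hypothesis ch : CH.
Hypothesis bad_closed : forall A, bad A -> closed A.
Hypothesis good_big : forall V k, open V -> V !=set0 ->
  exists F, [/\ good F, F `<=` V & big bad k F].
Hypothesis good_image : forall (X : topologicalType) (e : cantor -> X) F,
  injective e -> continuous e -> (forall V, open V -> open (e @` V)) -> closed (range e) ->
  good F -> calA (e @` F).
Hypothesis bad_preimage : forall (X : topologicalType) (e : cantor -> X) A,
  injective e -> continuous e -> (forall V, open V -> open (e @` V)) ->
  calB A -> A `<=` range e -> exists2 F, bad F & A `<=` e @` F.

(** The copies [range (i n)] are disjoint open sets that refute [calB], since [calB] selectors are
    covered by images of bad sets. The positive half allows sequences that are not disjoint, as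
    pseudocompactness will need. *)
Lemma separating_space : exists X : topologicalType, @ct_zd_T2 X /\
  (forall W : nat -> set X, (forall n, open (W n)) -> (forall n, W n !=set0) ->
    exists A, (forall n, calA (A n) /\ A n `<=` W n) /\
      exists x, accumulation_point_family A x) /\
  ~ sel_pseudocompact (@calB X).
Proof.
have [X [i [Xct ip i_inj sel nsel]]] := selective_space ch bad_closed good_big.
have e_inj n : injective (i n) by move=> c d /i_inj[].
exists X; split=> //; split.
  move=> W oW W0; have [A [k [AW [x Ax]]]] := sel W oW W0.
  exists (fun n => i (k n) @` A n); split; last by exists x.
  move=> n; have [gA ?] := AW n; split=> //.
  by have [? ? ?] := ip (k n); exact: good_image.
move=> /(_ (fun n => range (i n))) [].
- by move=> n; have [_ io _] := ip n; apply: io; exact: openT.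
- by move=> n; exists (i n (fun=> false)), (fun=> false).
- move=> n m nm; apply/seteqP; split=> // _ [[c _ <-] [d _ /i_inj[mn _]]].
  by apply: nm.
move=> A [AB [x Ax]].
have /choice[F FP] n : exists F, bad F /\ A n `<=` i n @` F.
  have [BA Ai] := AB n; have [ic io _] := ip n.
  by have [F ? ?] := bad_preimage (@e_inj n) ic io BA Ai; exists F.
apply: (nsel F x); first by move=> n; have [] := FP n.
by apply: accumulation_point_mono Ax => n; have [] := FP n.
Qed.
End Selection.

(** For unbounded [f] the decreasing sets [W n] are non-empty, so subsets of them accumulate at some
    [x]; but [|f|] stays below [|f x| + 1] near [x], which excludes all large [n]. *)
Lemma sel_pseudocompactT_pseudocompact (X : topologicalType) :
  (forall W : nat -> set X, (forall n, open (W n)) -> (forall n, W n !=set0) ->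
    exists A, (forall n, setT (A n) /\ A n `<=` W n) /\
      exists x, accumulation_point_family A x) ->
  @pseudocompact X.
Proof.
move=> sel f fc; apply: contrapT => unb.
pose W n := [set x | n%:R < `|f x|]%R.
have near_f x (e : Rdefinitions.R) : (0 < e)%R -> nbhs x [set y | `|f x - f y| < e]%R.
  move=> e0; suff /(fc x) : nbhs (f x) [set r | `|f x - r| < e]%R by [].
  by apply/nbhs_ballP; exists e.
have tri x y : (`|f x| <= `|f x - f y| + `|f y|)%R.
  by rewrite -{1}(subrK (f y) (f x)) ler_normD.
have [n|n|A [AW [x Ax]]] := sel W.
- rewrite openE => x nx; have := near_f x (`|f x| - n%:R)%R.
  rewrite subr_gt0 => /(_ nx); apply: filterS => y /= xy.
  by have := tri x y; rewrite /W/=; lra.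
- apply: contrapT => W0; apply: unb; exists n%:R%R => x.
  by rewrite leNgt; apply/negP => xn; apply: W0; exists x.
have := Ax [set y | `|f y| < `|f x| + 1]%R; apply.
  apply: filterS (near_f x 1%R ltr01) => y /=; rewrite distrC => xy.
  by have := tri y x; lra.
apply: (sub_finite_set _ (finite_II (Num.bound (`|f x| + 1)%R))) => n /=.
move=> [y [Ay yx]]; have [_ /(_ y Ay) ny] := AW n.
rewrite -(ltr_nat Rdefinitions.R); apply: (lt_trans ny); apply: (lt_trans yx).
by apply: archi_boundP; rewrite addr_ge0.
Qed.

Theorem theorem1p5 : CH ->
  (exists X1 : topologicalType, @ct_zd_T2 X1 /\ @fin_SP X1 /\ ~ @one_SP X1) /\
  (exists X2 : topologicalType, @ct_zd_T2 X2 /\ @ClScat_SP X2 /\ ~ @fin_SP X2) /\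
  (exists X3 : topologicalType, @ct_zd_T2 X3 /\ @Scat_SP X3 /\ ~ @ClScat_SP X3) /\
  (exists X4 : topologicalType, @ct_zd_T2 X4 /\ @pseudocompact X4 /\ ~ @Nwd_SP X4).
Proof.
have T2 : hausdorff_space cantor by apply: trace_hausdorff => x y.
move=> ch; split; [|split; [|split]].
- have [|V k oV V0|X e F|X e A|X [ctX [selX nselX]]] := @separating_space
    (@singletons cantor) finite_set (@finite_subsets) (@singletons) ch.
  + move=> _ [x ->]; apply: compact_closed => //; exact: compact_set1.
  + exact: finite_big.
  + by move=> _ _ _ _ Ffin; exact: finite_image.
  + move=> _ _ _ [x ->] /(_ x erefl)[c _ cx]; exists [set c]; first by exists c.
    by move=> _ ->; exists c.
  by exists X; split=> //; split=> // W oW W0 _; exact: selX.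
- have [|V k oV V0|X e F|X e A|X [ctX [selX nselX]]] := @separating_space
    finite_set (@closed_scattered_subsets cantor) (@closed_scattered_subsets)
    (@finite_subsets) ch.
  + by move=> A Afin; apply: compact_closed => //; exact: finite_compact.
  + exact: closed_scattered_big.
  + by move=> ei ec eo er [cF sF]; split; [exact: image_closed|exact: image_scattered].
  + move=> ei _ _ Afin Ae; exists (e @^-1` A); last by rewrite preimage_image_sub.
    by apply: finite_preimage => // x y _ _; exact: ei.
  by exists X; split=> //; split=> // W oW W0 _; exact: selX.
- have [|V k oV V0|X e F|X e A|X [ctX [selX nselX]]] := @separating_space
    (@closed_scattered_subsets cantor) (@scattered cantor) (@scattered_subsets)
    (@closed_scattered_subsets) ch.
  + by move=> A [].
  + exact: scattered_big.
  + by move=> ei ec eo er sF; exact: image_scattered.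
  + move=> ei ec eo [cA sA] Ae; exists (e @^-1` A); last by rewrite preimage_image_sub.
    by split; [exact: preimage_closed|exact: preimage_scattered].
  by exists X; split=> //; split=> // W oW W0 _; exact: selX.
- have [|V k oV V0|X e F|X e A|X [ctX [selX nselX]]] := @separating_space
    [set A : set cantor | closed A /\ interior A = set0] setT (fun=> setT)
    (@nowhere_dense_subsets) ch.
  + by move=> A [].
  + exact: open_big.
  + by [].
  (* Bad sets have to be closed, so the closure of the preimage is taken. *)
  + move=> ei ec eo nA Ae; exists (closure (e @^-1` A)).
      by split; [exact: closed_closure|exact: preimage_nowhere_dense].
    rewrite -{1}(preimage_image_sub Ae); apply: image_subset; exact: subset_closure.
  exists X; split=> //; split=> //.
  exact: sel_pseudocompactT_pseudocompact.
Qed.
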